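(* Let $q=p^r$ for some prime $p$ and some positive integer $r$, let $n\geq 2$ be an integer, and suppose that the number $d(n)$ of positive divisors of $n$ satisfies $d(n)<q+2$. Let $M_1$ be a field with $\mathbb{F}_q\subseteq M_1\subsetneq\mathbb{F}_{q^n}$ and $[M_1:\mathbb{F}_q]=\psi(\mathbb{F}_{q^n},\mathbb{F}_q)$, and let $W$ be a primitive $\mathbb{F}_q$-subspace of $\mathbb{F}_{q^n}$ with $\dim_{\mathbb{F}_q}W=\phi(\mathbb{F}_{q^n},\mathbb{F}_q)$. Assume that $W$ has a subspace partition $\{W_1,\ldots,W_l\}$ with $\dim_{\mathbb{F}_q}W_i=t_i\leq\psi(\mathbb{F}_{q^n},\mathbb{F}_q)$ for $1\leq i\leq l$. Then one can define, for each $\alpha\in M_1\setminus\{0\}$ and each $1\leq i\leq l$, a $t_i$-dimensional $\mathbb{F}_q$-subspace $W_{i_\alpha}$ of $\mathbb{F}_{q^n}$ such that $W$, $M_1$ and the subspaces $W_{i_\alpha}$ ($1\leq i\leq l$, $\alpha\in M_1\setminus\{0\}$) form a partition of $\mathbb{F}_{q^n}$.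
   Context: For a finite field extension $K\subset F$ (with $F\neq K$), a $K$-subspace $A$ of $F$ is called a primitive $K$-subspace of $F$ if $K(a)=F$ for every $a\in A\setminus\{0\}$. Define $$\psi(F,K)=\max\{[M:K] : M \text{ is a field with } K\subseteq M\subsetneq F\}$$ (so $M=K$ is allowed), and $$\phi(F,K)=\max\{\dim_K V : V \text{ is a primitive } K\text{-subspace of } F\}.$$ For an $\mathbb{F}_q$-subspace $V$ of $\mathbb{F}_{q^n}$ (possibly $V=\mathbb{F}_{q^n}$), a set $\{U_i\}_{i=1}^{\ell}$ of $\mathbb{F}_q$-subspaces of $V$ is called a (subspace) partition of $V$ if every nonzero element of $V$ lies in $U_i$ for exactly one $i$. *)

(* Defs.v *)
From mathcomp Require Import all_boot all_order all_algebra all_field.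
From mathcomp Require Import boolp.

Set Implicit Arguments.
Unset Strict Implicit.
Unset Printing Implicit Defensive.

Import GRing.Theory.
Local Open Scope ring_scope.

Section Subspaces.
Variables (K : fieldType) (F : fieldExtType K).

Definition primitive_subspace (A : {vspace F}) : Prop :=
  forall a : F, a \in A -> a != 0 -> <<1; a>>%VS = {:F}%VS.

(* Elements of {subfield F} contain the base field K, so these are exactly    *)
(* the intermediate fields M with K <= M and M <> F.                          *)
Definition proper_subfield (M : {subfield F}) : Prop :=
  (M : {vspace F}) <> {:F}%VS.

(* Both maxima below range over dimensions, all of which are at most [F : K]. *)
(* The maximum is over a nonempty set as soon as F <> K (M = K for psi, V = 0 *)
(* for phi), so the default value 0 of \max is never used in that case.       *)
Definition psi : nat :=
  \max_(d < (\dim {:F}).+1 |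
        `[< exists2 M : {subfield F}, proper_subfield M & \dim M = d >]) d.

Definition phi : nat :=
  \max_(d < (\dim {:F}).+1 |
        `[< exists2 V : {vspace F}, primitive_subspace V & \dim V = d >]) d.

Definition subspace_partition (I : Type) (U : I -> {vspace F})
    (V : {vspace F}) : Prop :=
  (forall i, (U i <= V)%VS) /\
  (forall v : F, v \in V -> v != 0 -> exists! i, v \in U i).

Definition nonzero_of (M : {vspace F}) : Type :=
  {a : F | (a \in M) && (a != 0)}.

End Subspaces.

Arguments psi {K} F.
Arguments phi {K} F.

(* Main.v *)
Require Import Defs.
From mathcomp Require Import all_boot all_order all_algebra all_field.
From mathcomp Require Import boolp.

Set Implicit Arguments.
Unset Strict Implicit.
Unset Printing Implicit Defensive.

Import GRing.Theory.
Local Open Scope ring_scope.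

(** The theorem reduces to the splitting [F = W (+) M1], where [F] is the big
    field. Once it is known, every vector that lies neither in [W] nor in [M1]
    is [w + u] with [w] in [W] and [u] in [M1] both nonzero. The part [W_i]
    that contains [w] has dimension at most [dim M1], so it embeds linearly in
    [M1] by some [f_i]; since [M1] is a field, [u = alpha * f_i w] for exactly
    one nonzero [alpha] in [M1]. Hence the graphs
    [W_(i,alpha) = { x + alpha * f_i x | x in W_i }] cover each such vector
    exactly once, and they have the dimension of [W_i]: this is
    [graph_partition].

    The splitting holds because a primitive subspace meets every proper
    subfield trivially ([primitive_disjoint]) and because
    [phi + psi >= [F : K]] ([dim_leq_phi_add_psi]). The latter asks for one
    primitive subspace of dimension [[F : K] - psi]. Being primitive means
    being disjoint from all the proper subfields. A finite field has at most
    one subfield of each degree ([subfield_dim_inj]), so there are at most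
    [d(n) - 1 <= q] of those, each of dimension at most [psi]. A subspace
    disjoint from all of them is built one dimension at a time
    ([exists_common_disjoint_subspace]); the bound [q] enters because [q]
    proper subspaces cannot cover a vector space over a field with [q]
    elements ([union_proper_subspaces_neq_full]). *)

(** ** Avoiding few subspaces over a finite field *)

(** By induction, some [v] avoids all the subspaces but one, [U]. If [v] is in
    [U], take [u] outside [U]: no point of the affine line [u + K v] is in [U],
    and every other subspace contains at most one point of it, since two
    points would put [v] in it. There are fewer other subspaces than points. *)
Lemma union_proper_subspaces_neq_full (K : finFieldType) (vT : vectType K)
    (s : seq {vspace vT}) :
  (size s <= #|K|)%N -> (forall U, U \in s -> U != fullv) ->
  exists v, forall U, U \in s -> v \notin U.
Proof.
elim: s => [|U s IHs] /= sz_s proper_s; first by exists 0.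
have [V sV | v s'v] := IHs (ltnW sz_s).
  by rewrite proper_s // inE sV orbT.
have [Uv | U'v] := boolP (v \in U); last first.
  by exists v => V /predU1P[-> | /s'v].
have /subvPn[u _ U'u]: ~~ (fullv <= U)%VS.
  by apply: contra (proper_s U (mem_head _ _)); rewrite eqEsubv subvf.
have [[c s'c] | no_c] :=
    pselect (exists c : K, forall V, V \in s -> u + c *: v \notin V).
  exists (u + c *: v) => V /predU1P[-> | /s'c //].
  by rewrite rpredDr ?rpredZ.
have ex_i c : exists i : 'I_(size s), u + c *: v \in tnth (in_tuple s) i.
  have /existsNP[V /not_implyP[/seq_tnthP[i ->] /negP]] :
    ~ forall V, V \in s -> u + c *: v \notin V by move=> ?; case: no_c; exists c.
  by rewrite negbK; exists i.
have [g gP] := choice ex_i.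
have g_inj : injective g.
  move=> c d eq_g; apply/eqP; rewrite -subr_eq0; apply: contraT => cd_neq0.
  have: (u + c *: v) - (u + d *: v) \in tnth (in_tuple s) (g c).
    by rewrite rpredB ?gP // eq_g gP.
  rewrite opprD addrACA subrr add0r -scalerBl.
  move/(rpredZ (c - d)^-1); rewrite scalerA mulVf // scale1r => gcv.
  by have := s'v _ (mem_tnth (g c) (in_tuple s)); rewrite gcv.
by have := leq_card g g_inj; rewrite card_ord leqNgt sz_s.
Qed.

(** Enlarging [W] by a line [<[v]>] keeps it disjoint from each [U] as soon as
    [v] avoids the subspaces [W + U], which are proper while
    [dim W + m < dim V]. *)
Lemma exists_common_disjoint_subspace (K : finFieldType) (vT : vectType K)
    (s : seq {vspace vT}) (m k : nat) :
  (size s <= #|K|)%N -> (forall U, U \in s -> (\dim U <= m)%N) ->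
  (k + m <= \dim {:vT})%N ->
  exists2 W : {vspace vT}, \dim W = k & forall U, U \in s -> (W :&: U = 0)%VS.
Proof.
(* A nonempty family makes v \notin W a consequence of v \notin W + U. *)
wlog s_neq0 : s / s != [::].
  have [-> nilP _ _ le_k | s_neq0] := eqVneq s [::]; last exact.
  have [||//|W dimW _] := nilP [:: 0%VS] isT; last by exists W.
    by apply: ltnW (finNzRing_gt1 K).
  by move=> _ /predU1P[->|//]; rewrite dimv0.
move=> sz_s dim_s; elim: k => [|k IHk] le_k.
  by exists 0%VS; rewrite ?dimv0 // => U _; rewrite cap0v.
have [W dimW WU0] := IHk (ltnW le_k).
have [||v s'v] :=
    @union_proper_subspaces_neq_full K vT [seq (W + U)%VS | U <- s].
- by rewrite size_map.
- move=> _ /mapP[U sU ->]; apply: contraTneq le_k => WUfull.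
  by rewrite -WUfull dimv_disjoint_sum ?WU0 // dimW -ltnNge ltnS leq_add2l dim_s.
have {}s'v U : U \in s -> v \notin (W + U)%VS by move=> sU; apply/s'v/map_f.
have W'v : v \notin W.
  case: s s_neq0 s'v {IHk sz_s dim_s WU0} => // U s _ /(_ U (mem_head _ _)).
  by apply: contra => Wv; rewrite (subvP (addvSl _ _)).
have v_neq0 : v != 0 by apply: contraNneq W'v => ->; rewrite mem0v.
exists (W + <[v]>)%VS.
  rewrite dimv_disjoint_sum ?dimW ?dim_vline ?v_neq0 ?addn1 //.
  apply/eqP; rewrite -subv0; apply/subvP=> x /memv_capP[Wx /vlineP[c Dx]].
  rewrite memv0 Dx; have [->|c_neq0] := eqVneq c 0; first by rewrite scale0r.
  by case/negP: W'v; rewrite -(scalerK c_neq0 v) -Dx rpredZ.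
move=> U sU; apply/eqP; rewrite -subv0; apply/subvP=> x /memv_capP[].
case/memv_addP=> w Ww [_ /vlineP[c ->] ->] Ux.
have [c0 | c_neq0] := eqVneq c 0.
  by rewrite -(WU0 U sU) memv_cap Ux c0 scale0r addr0 Ww.
case/negP: (s'v U sU); rewrite -(scalerK c_neq0 v) rpredZ //.
by rewrite -[c *: v](addKr w) memv_add ?rpredN.
Qed.

(** ** Primitive subspaces and proper subfields *)

(** A subfield of degree [d] is the set of solutions of [x ^+ (q ^ d) = x]. *)
Lemma subfield_dim_inj (K : finFieldType) (L : fieldExtType K)
    (E1 E2 : {subfield L}) :
  \dim E1 = \dim E2 -> E1 = E2 :> {vspace L}.
Proof. by move=> eqd; apply/vspaceP=> x; rewrite !Fermat's_little_theorem eqd. Qed.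

Section Primitive.
Variables (K : fieldType) (L : fieldExtType K).
Implicit Types (M : {subfield L}) (A : {vspace L}).

Lemma proper_subfield_dim M : proper_subfield M -> (\dim M < \dim {:L})%N.
Proof.
move=> /eqP pM; rewrite ltn_neqAle dimvS ?subvf // andbT.
by rewrite (dimv_leqif_eq (subvf M)).
Qed.

Lemma dim_proper_subfield_le_psi M : proper_subfield M -> (\dim M <= psi L)%N.
Proof.
move=> pM; have ltM : (\dim M < (\dim {:L}).+1)%N by rewrite ltnS dimvS ?subvf.
by apply: (@leq_bigmax_cond _ _ _ (Ordinal ltM)); apply/asboolP; exists M.
Qed.

Lemma dim_primitive_le_phi A : primitive_subspace A -> (\dim A <= phi L)%N.
Proof.
move=> pA; have ltA : (\dim A < (\dim {:L}).+1)%N by rewrite ltnS dimvS ?subvf.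
by apply: (@leq_bigmax_cond _ _ _ (Ordinal ltA)); apply/asboolP; exists A.
Qed.

(** A nonzero common element would generate all of [L], inside [M]. *)
Lemma primitive_disjoint A M :
  primitive_subspace A -> proper_subfield M -> (A :&: M = 0)%VS.
Proof.
move=> pA pM; apply/eqP; rewrite -subv0; apply/subvP=> a /memv_capP[Aa Ma].
rewrite memv0; apply: contraT => a_neq0; case: pM; apply/eqP.
by rewrite eqEsubv subvf -(pA a Aa a_neq0) sub_adjoin1v.
Qed.

(** If a nonzero [a] in [A] did not generate [L], then [K(a)] would be a proper
    subfield that meets [A]. *)
Lemma disjoint_primitive A :
  (forall M, proper_subfield M -> (A :&: M = 0)%VS) -> primitive_subspace A.
Proof.
move=> disjA a Aa a_neq0; apply: contrapT => /(disjA <<1; a>>%AS) cap0.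
by case/negP: a_neq0; rewrite -memv0 -cap0 memv_cap Aa memv_adjoin.
Qed.

End Primitive.

(** The degrees of the proper subfields are divisors of [n] other than [n], and
    each degree determines the subfield; so [d(n) - 1 <= #|K|] subspaces of
    dimension at most [psi] have to be avoided. *)
Lemma dim_leq_phi_add_psi (K : finFieldType) (L : fieldExtType K) :
  (size (divisors (\dim {:L})) < #|K| + 2)%N ->
  (\dim {:L} <= phi L + psi L)%N.
Proof.
set n := \dim _ => lt_div; have n_gt0 : (0 < n)%N := adim_gt0 _.
have le_psi : (psi L <= n)%N by apply/bigmax_leqP=> d _; rewrite -ltnS.
(* U d is the proper subfield of degree d if there is one, and 0 otherwise. *)
have ex_U (d : nat) : exists U : {vspace L}, (\dim U <= psi L)%N /\
    forall M : {subfield L}, proper_subfield M -> \dim M = d -> M = U :> {vspace L}.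
  have [[M [pM dM]] | noM] :=
      pselect (exists M : {subfield L}, proper_subfield M /\ \dim M = d).
    exists M; split=> [|M' _ dM']; first exact: dim_proper_subfield_le_psi.
    by apply: subfield_dim_inj; rewrite dM.
  by exists 0%VS; split=> [|M pM dM]; [rewrite dimv0 | case: noM; exists M].
have [U UP] := choice ex_U.
have [|||W dimW WU0] := @exists_common_disjoint_subspace K L
    [seq U d | d <- rem n (divisors n)] (psi L) (n - psi L).
- rewrite size_map size_rem -?dvdn_divisors //.
  by move: lt_div; case: size => // k; rewrite addn2 !ltnS.
- by move=> _ /mapP[d _ ->]; case: (UP d).
- by rewrite subnK.
rewrite addnC -leq_subLR -dimW.
apply/dim_primitive_le_phi/disjoint_primitive => M pM.
have [_ /(_ M pM erefl) ->] := UP (\dim M).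
apply/WU0/map_f; rewrite mem_rem_uniq ?divisors_uniq // inE -dvdn_divisors //.
by rewrite ltn_eqF ?proper_subfield_dim // field_dimS ?subvf.
Qed.

(** ** The partition by graphs *)

Lemma exists_linear_embedding (K : fieldType) (aT rT : vectType K)
    (U : {vspace aT}) (V : {vspace rT}) :
  (\dim U <= \dim V)%N ->
  exists f : 'Hom(aT, rT), (f @: U <= V)%VS /\ (U :&: lker f = 0)%VS.
Proof.
move=> le_dim; pose X := vbasis U; pose Y := take (\dim U) (vbasis V).
have szY : size Y = size X by rewrite size_takel ?size_tuple.
have freeY : free Y.
  apply: (@catl_free _ _ (drop (\dim U) (vbasis V))).
  by rewrite cat_take_drop (basis_free (vbasisP _)).
have [f /(_ (basis_free (vbasisP U)) szY) fX] := linear_of_free X Y.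
have fU : (linfun f @: U = <<Y>>)%VS.
  rewrite -(span_basis (vbasisP U)) limg_span -fX.
  by congr <<_>>%VS; apply: eq_map => x; rewrite lfunE.
exists (linfun f); split.
  by rewrite fU; apply/span_subvP=> y /mem_take; apply: vbasis_mem.
apply/eqP; rewrite -dimv_eq0 -(eqn_add2r (\dim (linfun f @: U))).
by rewrite limg_ker_dim fU (eqP freeY) szY size_tuple.
Qed.

(** Fixing embeddings [f i : Wi i -> M], the new parts are the graphs of the
    maps [x |-> a * f i x]. A vector [w + u] with both components nonzero
    determines [i] by [w], and then [a = u / f i w]. *)
Lemma graph_partition (K : fieldType) (L : fieldExtType K) (M : {subfield L})
    (W : {vspace L}) (I : finType) (Wi : I -> {vspace L}) :
  (W :&: M = 0)%VS -> (W + M = {:L})%VS -> subspace_partition Wi W ->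
  (forall i, (\dim (Wi i) <= \dim M)%N) ->
  exists Wa : I -> nonzero_of M -> {vspace L},
    (forall i a, \dim (Wa i a) = \dim (Wi i)) /\
    subspace_partition
      (fun j : bool + I * nonzero_of M =>
         match j with
         | inl true => W
         | inl false => (M : {vspace L})
         | inr (i, a) => Wa i a
         end)
      {:L}%VS.
Proof.
move=> WM0 WMfull [sWiW Wi_uniq] le_dim.
have [f fP] := fin_all_exists (fun i => exists_linear_embedding (le_dim i)).
have fM i x : x \in Wi i -> f i x \in M.
  by case: (fP i) => sfM _ Wx; apply: (subvP sfM); apply: memv_img.
have f_inj i x : x \in Wi i -> f i x = 0 -> x = 0.
  case: (fP i) => _ ker0 Wx fx0; apply/eqP.
  by rewrite -memv0 -ker0 memv_cap Wx memv_ker fx0 eqxx.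
have decomp w u w' u' : w \in W -> u \in M -> w' \in W -> u' \in M ->
    w + u = w' + u' -> w = w' /\ u = u'.
  move=> Ww Mu Ww' Mu' Dwu.
  have Dw : w - w' = u' - u.
    by apply/eqP; rewrite subr_eq addrAC [u' + _]addrC -Dwu addrK.
  have: w - w' \in (W :&: M)%VS by rewrite memv_cap rpredB // Dw rpredB.
  rewrite WM0 memv0 subr_eq0 => /eqP Ew; split=> //.
  by move: Dwu; rewrite Ew => /addrI.
pose Wa i (a : nonzero_of M) := ((\1 + (amull (val a) \o f i))%VF @: Wi i)%VS.
(* Membership in a graph is read off the two components of a vector. *)
have memWa i a w u : w \in W -> u \in M ->
    (w + u \in Wa i a) <-> (w \in Wi i /\ u = val a * f i w).
  move=> Ww Mu; have /andP[Ma _] := valP a; split.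
    case/memv_imgP=> x Wx; rewrite add_lfunE id_lfunE comp_lfunE !lfunE /= => E.
    have Wx' := subvP (sWiW i) x Wx.
    by have [-> ->] := decomp _ _ _ _ Ww Mu Wx' (memvM Ma (fM _ _ Wx)) E.
  case=> Wx ->; apply/memv_imgP; exists w => //.
  by rewrite add_lfunE id_lfunE comp_lfunE !lfunE.
exists Wa; split=> [i a|].
  apply/limg_dim_eq/eqP; rewrite -subv0; apply/subvP=> x /memv_capP[Wx].
  have /andP[Ma a_neq0] := valP a.
  rewrite memv_ker add_lfunE id_lfunE comp_lfunE !lfunE /= => /eqP E.
  have Wx' := subvP (sWiW i) x Wx.
  rewrite -[RHS in _ = RHS]addr0 in E.
  have Mafx := memvM Ma (fM _ _ Wx).
  by have [-> _] := decomp _ _ _ _ Wx' Mafx (mem0v _) (mem0v _) E; rewrite mem0v.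
split=> [j|v _ v_neq0]; first exact: subvf.
have /memv_addP[w Ww [u Mu Dv]]: v \in (W + M)%VS by rewrite WMfull memvf.
have inW : v \in W <-> u = 0.
  split=> [Wv | u0]; last by rewrite Dv u0 addr0.
  by have [] := decomp w u v 0 Ww Mu Wv (mem0v _); rewrite ?addr0.
have inM : v \in M <-> w = 0.
  split=> [Mv | w0]; last by rewrite Dv w0 add0r.
  by have [] := decomp w u 0 v Ww Mu (mem0v _) Mv; rewrite ?add0r.
have inWa i a := memWa i a w u Ww Mu; rewrite -Dv in inWa.
have [u0 | u_neq0] := eqVneq u 0.
  exists (inl true); split=> [|[[]|[i a]]] //; first exact/inW.
    by move/inM=> w0; case/eqP: v_neq0; rewrite Dv w0 u0 addr0.
  case/inWa=> Wiw /esym/eqP; rewrite u0 mulf_eq0.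
  have /andP[_ /negPf->] := valP a => /eqP/(f_inj _ _ Wiw) w0.
  by case/eqP: v_neq0; rewrite Dv w0 u0 addr0.
have [w0 | w_neq0] := eqVneq w 0.
  exists (inl false); split=> [|[[]|[i a]]] //; first exact/inM.
    by move/inW=> u0; case/eqP: u_neq0.
  by case/inWa=> _ /eqP; rewrite w0 linear0 mulr0 (negPf u_neq0).
have [i [Wiw i_uniq]] := Wi_uniq w Ww w_neq0.
have fw_neq0 : f i w != 0.
  by apply: contra_neq w_neq0 => /(f_inj _ _ Wiw).
have Ma : (u / f i w \in M) && (u / f i w != 0).
  by rewrite memvM ?memvV ?fM // mulf_neq0 ?invr_neq0.
exists (inr (i, exist _ (u / f i w) Ma)); split=> [|[[]|[i' a]]].
- by apply/inWa; rewrite /= divfK.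
- by move/inW=> u0; case/eqP: u_neq0.
- by move/inM=> w0; case/eqP: w_neq0.
case/inWa=> /i_uniq <- Du; congr (inr (_, _)).
by apply: val_inj; rewrite /= Du mulfK.
Qed.

Theorem theorem3 (p r q n : nat) (hp : prime p) (hr : (0 < r)%N)
    (hq : q = (p ^ r)%N) (hn : (2 <= n)%N)
    (hd : (size (divisors n) < q + 2)%N)
    (Fq : finFieldType) (hFq : #|Fq| = q)
    (Fqn : fieldExtType Fq) (hFqn : \dim {:Fqn} = n)
    (M1 : {subfield Fqn}) (hM1 : proper_subfield M1)
    (hM1dim : \dim M1 = psi Fqn)
    (W : {vspace Fqn}) (hW : primitive_subspace W)
    (hWdim : \dim W = phi Fqn)
    (l : nat) (t : 'I_l -> nat) (Wi : 'I_l -> {vspace Fqn})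
    (hWi : subspace_partition Wi W)
    (ht : forall i : 'I_l, \dim (Wi i) = t i)
    (htpsi : forall i : 'I_l, (t i <= psi Fqn)%N) :
  exists Wa : 'I_l -> nonzero_of M1 -> {vspace Fqn},
    (forall (i : 'I_l) (a : nonzero_of M1), \dim (Wa i a) = t i) /\
    subspace_partition
      (fun j : bool + 'I_l * nonzero_of M1 =>
         match j with
         | inl true => W
         | inl false => (M1 : {vspace Fqn})
         | inr (i, a) => Wa i a
         end)
      {:Fqn}%VS.
Proof.
have WM0 := primitive_disjoint hW hM1.
have WMfull : (W + M1 = {:Fqn})%VS.
  apply/eqP; rewrite eqEdim subvf dimv_disjoint_sum // hWdim hM1dim.
  by rewrite dim_leq_phi_add_psi // hFqn hFq.
have [|Wa [dimWa partWa]] := graph_partition WM0 WMfull hWi.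
  by move=> i; rewrite ht hM1dim htpsi.
by exists Wa; split=> // i a; rewrite dimWa ht.
Qed.
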